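(* Let $X$ and $Y$ be operator spaces, and let $B_X$ be the closed unit ball of $X$. If $f\colon B_X\to Y$ is a completely coarse map with $f(0)=0$, then $f$ is the restriction to $B_X$ of an $\mathbb{R}$-linear map $X\to Y$.
   Context: Operator spaces are complex: an operator space is a closed linear subspace $X\subseteq \mathcal B(H)$ for some complex Hilbert space $H$. $\mathrm M_n(X)$ denotes the space of $n\times n$ matrices with entries in $X$, normed through $\mathrm M_n(X)\subseteq \mathrm M_n(\mathcal B(H))\cong\mathcal B(H^{\oplus n})$. For a subset $B\subseteq X$, $\mathrm M_n(B)$ is the set of $n\times n$ matrices with all entries in $B$, and for a map $f\colon B\to Y$ the $n$-amplification is $f_n([x_{ij}])=[f(x_{ij})]$. A map $f\colon B\to Y$ is completely coarse if for all $r>0$ there is $s>0$ such that, for all $n\in\mathbb N$ and all $[x_{ij}],[y_{ij}]\in \mathrm M_n(B)$, $\|[x_{ij}]-[y_{ij}]\|_{\mathrm M_n(X)}\le r$ implies $\|f_n([x_{ij}])-f_n([y_{ij}])\|_{\mathrm M_n(Y)}\le s$. *)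

(* Defs.v *)
From HB Require Import structures.
From mathcomp Require Import all_boot all_order all_algebra.
From mathcomp Require Import sesquilinear complex.
From mathcomp Require Import all_classical all_reals all_analysis.

Set Implicit Arguments.
Unset Strict Implicit.
Unset Printing Implicit Defensive.

Import Order.TTheory GRing.Theory Num.Theory.
Import numFieldNormedType.Exports.
Import complex.

Local Open Scope classical_set_scope.
Local Open Scope complex_scope.
Local Open Scope ring_scope.

Record hilbertType (R : realType) := HilbertType {
  hilbert_sort :> completeNormedModType R[i];
  hilbert_dot : {dot hilbert_sort for Num.conj};
  hilbert_normE : forall x : hilbert_sort, `|x| ^+ 2 = hilbert_dot x x
}.

(* Norms in a normed module over R[i] take their values in R[i], although they
   are real numbers; [rnorm] is the same number in R. *)
Definition rnorm (R : realType) (V : normedModType R[i]) (x : V) : R :=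
  complex.Re `|x|.

Lemma rnormE (R : realType) (V : normedModType R[i]) (x : V) : `|x| = (rnorm x)%:C.
Proof.
by rewrite /rnorm RRe_real ?normr_real.
Qed.

Lemma rnorm_ge0 (R : realType) (V : normedModType R[i]) (x : V) : 0 <= rnorm x.
Proof. by rewrite -lecR -rnormE normr_ge0. Qed.

Lemma rnormD (R : realType) (V : normedModType R[i]) (x y : V) :
  rnorm (x + y) <= rnorm x + rnorm y.
Proof. by rewrite -lecR rmorphD /= -!rnormE ler_normD. Qed.

Lemma rnormZ (R : realType) (V : normedModType R[i]) (a : R[i]) (x : V) :
  rnorm (a *: x) = complex.Re `|a| * rnorm x.
Proof.
by rewrite /rnorm normrZ -(@RRe_real _ `|a|) ?normr_real// -(@RRe_real _ `|x|)
  ?normr_real// -rmorphM.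
Qed.

Lemma rnorm0 (R : realType) (V : normedModType R[i]) : rnorm (0 : V) = 0.
Proof. by rewrite /rnorm normr0. Qed.

Lemma rnorm0_eq0 (R : realType) (V : normedModType R[i]) (x : V) : rnorm x = 0 -> x = 0.
Proof. by move=> x0; apply: normr0_eq0; rewrite rnormE x0. Qed.

Section BoundedOperators.
Variables (R : realType) (H : hilbertType R).

Definition is_bounded_op (T : H -> H) : Prop :=
  linear T /\ exists M : R, forall x, rnorm (T x) <= M * rnorm x.

Definition bounded_op_pred : {pred H -> H} := [pred T | `[< is_bounded_op T >]].

Record bounded_op := BoundedOp {
  bounded_op_fun :> H -> H;
  bounded_op_funP : bounded_op_fun \in bounded_op_pred
}.

HB.instance Definition _ := [isSub for bounded_op_fun].
HB.instance Definition _ := [Choice of bounded_op by <:].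

Lemma bounded_op_submod_closed : submod_closed bounded_op_pred.
Proof.
split=> [|a S T].
  apply/asboolP; split=> [b x y /=|].
    by rewrite scaler0 addr0.
  by exists 0 => x /=; rewrite rnorm0 mul0r.
move=> /asboolP[lS [M SM]] /asboolP[lT [N TN]]; apply/asboolP; split.
  move=> b x y; rewrite -[LHS]/(a *: S (b *: x + y) + T (b *: x + y)).
  rewrite -[RHS]/(b *: (a *: S x + T x) + (a *: S y + T y)) lS lT.
  rewrite !scalerDr !scalerA (mulrC b a) -!addrA; congr (_ + _).
  by rewrite addrCA.
exists (complex.Re `|a| * M + N) => x.
rewrite -[X in rnorm X]/(a *: S x + T x) mulrDl -mulrA.
apply: le_trans (rnormD _ _) _; apply: lerD; last exact: TN.
rewrite rnormZ; apply: ler_wpM2l; last exact: SM.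
by rewrite -lecR RRe_real ?normr_real ?normr_ge0.
Qed.

HB.instance Definition _ :=
  GRing.isSubmodClosed.Build _ _ bounded_op_pred bounded_op_submod_closed.
HB.instance Definition _ := [SubChoice_isSubLmodule of bounded_op by <:].

Lemma bounded_opP (T : bounded_op) : is_bounded_op T.
Proof. by case: T => T /= /asboolP. Qed.

Definition opnorm (T : bounded_op) : R :=
  sup [set rnorm (T x) | x in [set x | rnorm x <= 1]].

Lemma opnorm_has_sup (T : bounded_op) :
  has_sup [set rnorm (T x) | x in [set x | rnorm x <= 1]].
Proof.
split; first by exists (rnorm (T 0)), 0; rewrite //= rnorm0.
have [_ [M MT]] := bounded_opP T.
exists `|M| => _ [x /= x1 <-]; apply: le_trans (MT x) _.
apply: le_trans (ler_norm _) _; rewrite normrM ler_piMr//.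
by rewrite ger0_norm// rnorm_ge0.
Qed.

Lemma opnorm_ge (T : bounded_op) x : rnorm x <= 1 -> rnorm (T x) <= opnorm T.
Proof. by move=> x1; apply: (sup_upper_bound (opnorm_has_sup T)); exists x. Qed.

Lemma opnorm_le (T : bounded_op) (M : R) :
  (forall x, rnorm x <= 1 -> rnorm (T x) <= M) -> opnorm T <= M.
Proof.
move=> TM; apply: ge_sup; first by case: (opnorm_has_sup T).
by move=> _ [x /= x1 <-]; exact: TM.
Qed.

Lemma opnorm_ge0 (T : bounded_op) : 0 <= opnorm T.
Proof. by apply: le_trans (@opnorm_ge T 0 _); rewrite ?rnorm_ge0 ?rnorm0. Qed.

Let norm (T : bounded_op) : R[i] := (opnorm T)%:C.

Let ler_normD (S T : bounded_op) : norm (S + T) <= norm S + norm T.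
Proof.
rewrite /norm -rmorphD lecR; apply: opnorm_le => x x1.
by apply: le_trans (rnormD _ _) _; rewrite lerD ?opnorm_ge.
Qed.

Let opnormZ_le (a : R[i]) (T : bounded_op) :
  opnorm (a *: T) <= complex.Re `|a| * opnorm T.
Proof.
apply: opnorm_le => x x1.
rewrite -[X in rnorm X]/(a *: T x) rnormZ ler_wpM2l ?opnorm_ge//.
by rewrite -lecR RRe_real ?normr_real ?normr_ge0.
Qed.

Let normrZ (a : R[i]) (T : bounded_op) : norm (a *: T) = `|a| * norm T.
Proof.
rewrite /norm -[in RHS](@RRe_real _ `|a|) ?normr_real// -rmorphM; congr _%:C.
apply/le_anti; rewrite opnormZ_le andTb.
have [->|a0] := eqVneq a 0; first by rewrite normr0 mul0r opnorm_ge0.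
have Ra0 : 0 < complex.Re `|a| by rewrite -ltcR RRe_real ?normr_real// normr_gt0.
rewrite -ler_pdivlMl// -{1}(scalerK a0 T); apply: le_trans (opnormZ_le _ _) _.
by rewrite normfV -{1}(@RRe_real _ `|a|) ?normr_real// -fmorphV.
Qed.

Let normr0_eq0 (T : bounded_op) : norm T = 0 -> T = 0.
Proof.
move=> /complexI T0; apply/val_inj/funext => x /=.
have Tball y : rnorm y <= 1 -> T y = 0.
  move=> /(opnorm_ge T); rewrite T0 => Ty.
  by apply: rnorm0_eq0; apply/le_anti; rewrite Ty rnorm_ge0.
have [x1|/ltW x1] := leP (rnorm x) 1; first exact: Tball.
have x0 : rnorm x != 0 by rewrite gt_eqF// (lt_le_trans ltr01 x1).
have xC0 : (rnorm x)%:C != 0 by rewrite fmorph_eq0.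
have lT : linear T by case: (bounded_opP T).
have /Tball : rnorm ((rnorm x)%:C^-1 *: x) <= 1.
  by rewrite rnormZ normfV -rnormE normr_id rnormE -fmorphV mulVf.
have := lT (rnorm x)%:C^-1 x 0.
rewrite (Tball 0) ?rnorm0// !addr0 => ->.
by move=> /eqP; rewrite scaler_eq0 invr_eq0 (negPf xC0) => /eqP.
Qed.

HB.instance Definition _ := Lmodule_isNormed.Build R[i] bounded_op
  ler_normD normrZ normr0_eq0.

Lemma rnorm_opE (T : bounded_op) : rnorm T = opnorm T.
Proof. by []. Qed.

(* M_n(B(H)) = B(H^n): elements of the Hilbert direct sum H^n are functions
   'I_n -> H with the l2 norm, a matrix acts on them as on column vectors, and
   [mxopnorm] is the operator norm of this action. *)
Definition l2norm n (h : 'I_n -> H) : R :=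
  Num.sqrt (\sum_(i < n) rnorm (h i) ^+ 2).

Definition mxact n (A : 'M[bounded_op]_n) (h : 'I_n -> H) : 'I_n -> H :=
  fun i => \sum_(j < n) A i j (h j).

Definition mxopnorm n (A : 'M[bounded_op]_n) : R :=
  sup [set l2norm (mxact A h) | h in [set h : 'I_n -> H | l2norm h <= 1]].

Lemma rnorm_le_l2norm n (h : 'I_n -> H) i : rnorm (h i) <= l2norm h.
Proof.
rewrite /l2norm -[leLHS]ger0_norm ?rnorm_ge0// -sqrtr_sqr ler_wsqrtr//.
by rewrite (bigD1 i)//= lerDl sumr_ge0// => j _; rewrite sqr_ge0.
Qed.

Lemma rnorm_sum n (h : 'I_n -> H) :
  rnorm (\sum_(i < n) h i) <= \sum_(i < n) rnorm (h i).
Proof.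
apply: (big_ind2 (fun (u : H) v => rnorm u <= v)) => //; first by rewrite rnorm0.
by move=> u1 v1 u2 v2 le1 le2; apply: le_trans (rnormD _ _) _; exact: lerD.
Qed.

Lemma mxopnorm_has_sup n (A : 'M[bounded_op]_n) :
  has_sup [set l2norm (mxact A h) | h in [set h : 'I_n -> H | l2norm h <= 1]].
Proof.
split.
  exists (l2norm (mxact A (fun=> 0))), (fun=> 0) => //=.
  by rewrite /l2norm big1 ?sqrtr0// => i _; rewrite rnorm0 expr0n.
exists (Num.sqrt (\sum_(i < n) (\sum_(j < n) opnorm (A i j)) ^+ 2)).
move=> _ [h /= h1 <-]; apply: ler_wsqrtr; apply: ler_sum => i _.
rewrite ler_sqr ?nnegrE ?rnorm_ge0//; last first.
  by apply: sumr_ge0 => j _; exact: opnorm_ge0.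
apply: le_trans (rnorm_sum _) _; apply: ler_sum => j _; apply: opnorm_ge.
exact: le_trans (rnorm_le_l2norm h j) h1.
Qed.

End BoundedOperators.

(* [opspace_closed] is closedness for the topology of the operator norm. *)
Record opSpace (R : realType) := OpSpace {
  opspace_hilbert : hilbertType R;
  opspace_pred : {pred bounded_op opspace_hilbert};
  opspace_submod : submod_closed opspace_pred;
  opspace_closed : closed [set` opspace_pred]
}.

Arguments opspace_pred {R} X : rename.
Arguments opspace_submod {R} X : rename.
Arguments opspace_closed {R} X : rename.

Section OperatorSpaces.
Variables (R : realType) (X : opSpace R).

HB.instance Definition _ :=
  GRing.isSubmodClosed.Build _ _ (opspace_pred X) (opspace_submod X).

Record opspace_sort : predArgType := OpSpaceElt {
  opspace_val :> bounded_op (opspace_hilbert X);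
  opspace_valP : opspace_val \in opspace_pred X
}.

HB.instance Definition _ := [isSub for opspace_val].
HB.instance Definition _ := [Choice of opspace_sort by <:].
HB.instance Definition _ := [SubChoice_isSubLmodule of opspace_sort by <:].

Let norm (x : opspace_sort) : R[i] := `|opspace_val x|.

Let ler_normD (x y : opspace_sort) : norm (x + y) <= norm x + norm y.
Proof. exact: Num.Theory.ler_normD. Qed.

Let normrZ (a : R[i]) (x : opspace_sort) : norm (a *: x) = `|a| * norm x.
Proof. exact: normed_module.normrZ. Qed.

Let normr0_eq0 (x : opspace_sort) : norm x = 0 -> x = 0.
Proof. by move=> /Num.Theory.normr0_eq0 x0; apply: val_inj. Qed.

HB.instance Definition _ := Lmodule_isNormed.Build R[i] opspace_sort
  ler_normD normrZ normr0_eq0.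

Definition mxnorm n (A : 'M[opspace_sort]_n) : R :=
  mxopnorm (map_mx opspace_val A).

Definition unit_ball : set opspace_sort := [set x | rnorm x <= 1].

End OperatorSpaces.

Coercion opspace_sort : opSpace >-> predArgType.
Arguments unit_ball {R} X.

(* A map B -> Y is given by a total map X -> Y whose values outside B are
   irrelevant. *)
Definition completely_coarse (R : realType) (X Y : opSpace R) (B : set X)
    (f : X -> Y) : Prop :=
  forall r : R, 0 < r -> exists2 s : R, 0 < s &
    forall (n : nat) (x y : 'M[X]_n),
      (forall i j, B (x i j)) -> (forall i j, B (y i j)) ->
      mxnorm (x - y) <= r -> mxnorm (map_mx f x - map_mx f y) <= s.

(* R-linearity between spaces over R[i]: only real scalars come out of [g]. *)
Definition real_linear (R : realType) (X Y : lmodType R[i]) (g : X -> Y) : Prop :=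
  forall (a : R) (x y : X), g (a%:C *: x + y) = a%:C *: g x + g y.

(* Main.v *)
Require Import Defs.
From HB Require Import structures.
From mathcomp Require Import all_boot all_order all_algebra.
From mathcomp Require Import ring lra.
From mathcomp Require Import sesquilinear complex.
From mathcomp Require Import all_classical all_reals all_analysis.

Set Implicit Arguments.
Unset Strict Implicit.
Unset Printing Implicit Defensive.

Import Order.TTheory GRing.Theory Num.Theory.
Import numFieldNormedType.Exports.
Import complex.

Local Open Scope classical_set_scope.
Local Open Scope complex_scope.
Local Open Scope ring_scope.

(** Complete coarseness on large matrices forces the increments of [f] by a small
    vector to be almost the same at all points.  Let [S] be a matrix of signs of size [2n], [n = 4 ^ p], whose
    operator norm is of order [sqrt n] and whose signs cancel in pairs along each
    row.  For a small vector [w], the matrix with entries [+w] and [-w] placed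
    according to [S] has norm at most [2 ^ p.+1 * rnorm w]
    ([mxnorm_balanced_sign]).  It is the difference of two matrices [x] and [y]
    over the ball: where the sign is [+], [x] and [y] have entries [z + w] and
    [z]; where it is [-], they have entries [z'] and [z' + w].  Applying [f]
    entrywise gives entries [f (z + w) - f z] and [- (f (z' + w) - f z')], each
    filling half of every row, so the constant vector is mapped to
    [n] times the difference [d] of the two increments, up to normalization.
    If [s] is the bound that complete coarseness gives for all sizes at once, then
    [n * rnorm d <= s] ([coarse_second_difference]), although [rnorm w] may be as
    large as a constant times [1 / sqrt n].

    Now cut a fixed vector [v] into [2 ^ p.+1] equal steps [w].  Summing the
    estimate over the steps from [z] to [z + v] and from [z'] to [z' + v] gives
    an error of order [sqrt n / n], which tends to [0]; so
    [f (z + v) - f z] does not depend on [z] ([coarse_increment]).  With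
    [f 0 = 0] this says that [f] is additive on the ball, and it is bounded
    there.  Such a map extends to an additive map by rescaling with integers, and
    boundedness makes the extension homogeneous for real scalars
    ([additive_ball_real_linear]). *)

(** * Sign matrices of small norm *)

Definition signed (V : zmodType) (b : bool) (v : V) : V := if b then - v else v.

Lemma signedD (V : zmodType) b (u v : V) :
  signed b (u + v) = signed b u + signed b v.
Proof. by case: b; rewrite //= opprD. Qed.

Lemma signed_negb (V : zmodType) b (v : V) : signed (~~ b) v = signed b (- v).
Proof. by case: b; rewrite //= opprK. Qed.

(** Equal to [2 ^ m], but unfolding to a sum, so that the block matrices below
    have the right type without casts. *)
Fixpoint hadamard_order (m : nat) : nat :=
  if m is m'.+1 then (hadamard_order m' + hadamard_order m')%N else 1%N.

Lemma hadamard_orderE m : hadamard_order m = (2 ^ m)%N.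
Proof. by elim: m => //= m ->; rewrite addnn -mul2n expnS. Qed.

(** The Sylvester matrix of order [2 ^ m], with [true] for the sign [-1]. *)
Fixpoint hadamard_sign (m : nat) : 'M[bool]_(hadamard_order m) :=
  if m is m'.+1 then
    let S := hadamard_sign m' in block_mx S S S (map_mx negb S)
  else const_mx false.

(** The Sylvester matrix next to its opposite, twice: every row then has as many
    [+1] as [-1], at the cost of a factor [2] in the norm. *)
Definition balanced_sign m : 'M[bool]_(hadamard_order m + hadamard_order m) :=
  let S := hadamard_sign m in block_mx S (map_mx negb S) S (map_mx negb S).

Lemma rnorm_parallelogram (R : realType) (H : hilbertType R) (u v : H) :
  rnorm (u + v) ^+ 2 + rnorm (u - v) ^+ 2 =
  2 * (rnorm u ^+ 2 + rnorm v ^+ 2).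
Proof.
have sq w : (rnorm w ^+ 2)%:C = hilbert_dot H w w.
  by rewrite -hilbert_normE rnormE rmorphXn.
apply: complexI; rewrite [LHS]rmorphD mulr_natl [RHS]rmorphMn rmorphD /= !sq.
rewrite hnormD hnormB /=; ring.
Qed.

(** Up to the factor [2 ^ m] a Hadamard matrix acts isometrically on a Hilbert
    direct sum; the recursive step of the Sylvester construction is the
    parallelogram law. *)
Lemma hadamard_sign_l2 (R : realType) (H : hilbertType R) m
    (h : 'I_(hadamard_order m) -> H) :
  \sum_i rnorm (\sum_j signed (hadamard_sign m i j) (h j)) ^+ 2 =
  (2 ^ m)%:R * \sum_j rnorm (h j) ^+ 2.
Proof.
elim: m => [|m IH] /= in h *.
  by rewrite !big_ord1 !mxE expn0 mul1r.
rewrite !big_split_ord /=.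
under eq_bigr => i _.
  rewrite big_split_ord /=.
  under eq_bigr do rewrite block_mxEul.
  under [X in _ + X]eq_bigr do rewrite block_mxEur.
  rewrite -big_split /=; under eq_bigr do rewrite -signedD.
  over.
under [X in _ + X = _]eq_bigr => i _.
  rewrite big_split_ord /=.
  under eq_bigr do rewrite block_mxEdl.
  under [X in _ + X]eq_bigr do rewrite block_mxEdr mxE signed_negb.
  rewrite -big_split /=; under eq_bigr do rewrite -signedD.
  over.
rewrite !IH -mulrDr -!big_split /=.
under eq_bigr do rewrite rnorm_parallelogram.
by rewrite -mulr_sumr mulrA -natrM expnSr.
Qed.

(** The balanced matrix applies the Sylvester matrix, twice, to the difference of
    the two halves of [h]. *)
Lemma balanced_sign_l2 (R : realType) (H : hilbertType R) m
    (h : 'I_(hadamard_order m + hadamard_order m) -> H) :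
  \sum_i rnorm (\sum_j signed (balanced_sign m i j) (h j)) ^+ 2 <=
  4 * (2 ^ m)%:R * \sum_j rnorm (h j) ^+ 2.
Proof.
rewrite !big_split_ord /=.
under eq_bigr => i _.
  rewrite big_split_ord /=.
  under eq_bigr do rewrite block_mxEul.
  under [X in _ + X]eq_bigr do rewrite block_mxEur mxE signed_negb.
  rewrite -big_split /=; under eq_bigr do rewrite -signedD.
  over.
under [X in _ + X <= _]eq_bigr => i _.
  rewrite big_split_ord /=.
  under eq_bigr do rewrite block_mxEdl.
  under [X in _ + X]eq_bigr do rewrite block_mxEdr mxE signed_negb.
  rewrite -big_split /=; under eq_bigr do rewrite -signedD.
  over.
rewrite !hadamard_sign_l2 -big_split /=.
set a : R := (2 ^ m)%:R; set d := \sum_(j < _) _; set s := \sum_(i < _) _.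
have ds : d <= 2 * s.
  rewrite /d /s mulr_sumr; apply: ler_sum => j _.
  by rewrite -rnorm_parallelogram lerDr sqr_ge0.
have := ler_wpM2l (ler0n R (2 ^ m)) ds; rewrite -/a => ads.
lra.
Qed.

Lemma balanced_sign_rshift m i j :
  balanced_sign m i (rshift _ j) = ~~ balanced_sign m i (lshift _ j).
Proof.
rewrite /balanced_sign; have [i' ->|i' ->] := split_ordP i.
  by rewrite block_mxEur block_mxEul mxE.
by rewrite block_mxEdr block_mxEdl mxE.
Qed.

(** * Norms of operators and of matrices over an operator space *)

Lemma rnormZ_real (R : realType) (V : normedModType R[i]) (a : R) (x : V) :
  rnorm (a%:C *: x) = `|a| * rnorm x.
Proof. by rewrite rnormZ normc_def /= expr0n addr0 sqrtr_sqr. Qed.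

Lemma rnormMn (R : realType) (V : normedModType R[i]) (x : V) n :
  rnorm (x *+ n) = n%:R * rnorm x.
Proof. by rewrite /rnorm normrMn raddfMn mulr_natl. Qed.

Definition natdiv (R : realType) (V : normedModType R[i]) (n : nat) (x : V) : V :=
  (n%:R^-1)%:C *: x.

Lemma natdivK (R : realType) (V : normedModType R[i]) n (x : V) :
  (0 < n)%N -> natdiv n x *+ n = x.
Proof.
move=> n0; rewrite /natdiv -scaler_nat scalerA -(rmorph_nat (real_complex R)).
by rewrite -rmorphM mulfV ?scale1r // pnatr_eq0 -lt0n.
Qed.

Lemma natdivD (R : realType) (V : normedModType R[i]) n (x y : V) :
  natdiv n (x + y) = natdiv n x + natdiv n y.
Proof. exact: scalerDr. Qed.

Lemma natdiv_mul (R : realType) (V : normedModType R[i]) m n (x : V) :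
  (0 < m)%N -> natdiv (m * n) x *+ m = natdiv n x.
Proof.
move=> m0; rewrite -[RHS](natdivK _ m0); congr (_ *+ m).
by rewrite /natdiv scalerA -rmorphM natrM invfM.
Qed.

Lemma rnorm_natdiv_le1 (R : realType) (V : normedModType R[i]) n (x : V) :
  (0 < n)%N -> rnorm x <= n%:R -> rnorm (natdiv n x) <= 1.
Proof.
move=> n0 xn; have n0R : 0 < n%:R :> R by rewrite ltr0n.
by rewrite -(ler_pM2l n0R) mulr1 -rnormMn natdivK.
Qed.

Lemma opnorm_bound (R : realType) (H : hilbertType R) (T : bounded_op H) (x : H) :
  rnorm (T x) <= opnorm T * rnorm x.
Proof.
have [lT _] := bounded_opP T.
have T0 : T 0 = 0.
  by have := lT (-1) 0 0; rewrite scaler0 addr0 scaleN1r addNr.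
have [/rnorm0_eq0 ->|x0] := eqVneq (rnorm x) 0.
  by rewrite T0 rnorm0 mulr0.
have xp : 0 < rnorm x by rewrite lt_neqAle eq_sym x0 rnorm_ge0.
have nV : `|(rnorm x)^-1| = (rnorm x)^-1 by rewrite ger0_norm // invr_ge0 ltW.
rewrite -ler_pdivrMr // mulrC -nV -rnormZ_real.
have := lT ((rnorm x)^-1)%:C x 0; rewrite T0 !addr0 => <-.
by apply: opnorm_ge; rewrite rnormZ_real nV mulVf.
Qed.

Lemma mxopnorm_ge (R : realType) (H : hilbertType R) n (A : 'M[bounded_op H]_n)
    (h : 'I_n -> H) :
  l2norm h <= 1 -> l2norm (mxact A h) <= mxopnorm A.
Proof.
by move=> h1; apply: (sup_upper_bound (mxopnorm_has_sup A)); exists h.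
Qed.

(** [w] acts entrywise before the signs do, so the norm is that of [w] times
    that of the sign matrix, whose square is at most [4 * 2 ^ (p + p)]. *)
Lemma mxnorm_balanced_sign (R : realType) (X : opSpace R) p (w : X) :
  mxnorm (\matrix_(i, j) signed (balanced_sign (p + p) i j) w) <=
  (2 ^ p.+1)%:R * rnorm w.
Proof.
apply: ge_sup => [|_ [h /= h1 <-]].
  by case: (mxopnorm_has_sup
    (map_mx (@opspace_val R X) (\matrix_(i, j) signed (balanced_sign (p + p) i j) w))).
have E i : mxact (map_mx (@opspace_val R X)
     (\matrix_(i, j) signed (balanced_sign (p + p) i j) w)) h i =
   \sum_j signed (balanced_sign (p + p) i j) (opspace_val w (h j)).
  by apply: eq_bigr => j _; rewrite !mxE /signed; case: ifP.
rewrite /l2norm; under eq_bigr do rewrite E.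
have w0 : 0 <= (2 ^ p.+1)%:R * rnorm w by rewrite mulr_ge0 ?rnorm_ge0.
rewrite -[leRHS]ger0_norm // -sqrtr_sqr; apply: ler_wsqrtr.
apply: le_trans (balanced_sign_l2 _) _.
have -> : ((2 ^ p.+1)%:R * rnorm w) ^+ 2 =
          4 * (2 ^ (p + p))%:R * (rnorm w) ^+ 2 :> R.
  by rewrite expnS expnD !natrM; ring.
apply: ler_wpM2l; first by rewrite mulr_ge0.
apply: (@le_trans _ _ (\sum_j (rnorm w ^+ 2 * rnorm (h j) ^+ 2))).
  apply: ler_sum => j _; rewrite -exprMn ler_sqr ?nnegrE ?mulr_ge0 ?rnorm_ge0 //.
  exact: opnorm_bound.
rewrite -mulr_sumr; apply: ler_piMr; first exact: sqr_ge0.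
have s0 : 0 <= \sum_j rnorm (h j) ^+ 2.
  by apply: sumr_ge0 => j _; exact: sqr_ge0.
by rewrite -(sqr_sqrtr s0) exprn_ile1 // sqrtr_ge0.
Qed.

Lemma l2norm_const (R : realType) (H : hilbertType R) n (u : H) :
  l2norm (fun _ : 'I_n => u) = Num.sqrt n%:R * rnorm u.
Proof.
rewrite /l2norm sumr_const card_ord -[rnorm u ^+ 2 *+ n]mulr_natl sqrtrM // sqrtr_sqr.
by rewrite ger0_norm // rnorm_ge0.
Qed.

(** Test [D] on the vector whose coordinates all equal [u]: pairing the two
    halves of each row turns every coordinate of the image into [d u *+ n]. *)
Lemma mxnorm_ge_paired (R : realType) (Y : opSpace R) n (D : 'M[Y]_(n + n))
    (d : Y) :
  (0 < n)%N ->
  (forall i j, D i (lshift n j) + D i (rshift n j) = d) ->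
  n%:R * rnorm d <= mxnorm D.
Proof.
move=> n0 Dd.
have n0R : 0 < n%:R :> R by rewrite ltr0n.
rewrite mulrC -ler_pdivlMr //; apply: opnorm_le => h h1.
rewrite ler_pdivlMr // mulrC.
(* Dividing [h] by [t] brings the constant vector into the unit ball of the
   direct sum of [n + n] copies. *)
set t : R := Num.sqrt (n + n)%:R.
have t0 : 0 < t by rewrite sqrtr_gt0 ltr0n addn_gt0 n0.
pose u := (t^-1)%:C *: h.
have nV : `|t^-1| = t^-1 by rewrite ger0_norm // invr_ge0 ltW.
have [ld _] := bounded_opP (opspace_val d).
have d0 : opspace_val d 0 = 0.
  by have := ld (-1) 0 0; rewrite scaler0 addr0 scaleN1r addNr.
have du : opspace_val d u = (t^-1)%:C *: opspace_val d h.
  by have := ld (t^-1)%:C h 0; rewrite d0 !addr0.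
have E : mxact (map_mx (@opspace_val R Y) D) (fun=> u) =
         fun=> opspace_val d u *+ n.
  apply/funext => i; rewrite /mxact big_split_ord /= -big_split /=.
  rewrite -[n in RHS]card_ord -sumr_const; apply: eq_bigr => j _.
  by rewrite !mxE -(Dd i j).
have := @mxopnorm_ge _ _ _ (map_mx (@opspace_val R Y) D) (fun=> u).
rewrite E !l2norm_const rnormMn du /u !rnormZ_real nV mulVKf ?gt_eqF //.
by move=> /(_ h1); rewrite mulrCA mulVKf ?gt_eqF.
Qed.

Lemma l2norm1 (R : realType) (H : hilbertType R) (h : 'I_1 -> H) :
  l2norm h = rnorm (h ord0).
Proof. by rewrite /l2norm big_ord1 sqrtr_sqr ger0_norm // rnorm_ge0. Qed.

Lemma mxnorm_const1 (R : realType) (X : opSpace R) (x : X) :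
  mxnorm (const_mx x : 'M[X]_1) = rnorm x.
Proof.
have act (h : 'I_1 -> opspace_hilbert X) :
    l2norm (mxact (map_mx (@opspace_val R X) (const_mx x)) h) =
    rnorm (opspace_val x (h ord0)).
  by rewrite l2norm1 /mxact big_ord1 !mxE.
apply/le_anti/andP; split.
  apply: ge_sup => [|_ [h /= h1 <-]]; first by case: (mxopnorm_has_sup
    (map_mx (@opspace_val R X) (const_mx x : 'M[X]_1))).
  by rewrite act opnorm_ge // -l2norm1.
apply: opnorm_le => h h1; rewrite -(act (fun=> h)).
by apply: mxopnorm_ge; rewrite l2norm1.
Qed.

(** * Increments of a completely coarse map *)

Lemma archimedean_le0 (R : realType) (t C : R) :
  (forall n : nat, n%:R * t <= C) -> t <= 0.
Proof.
move=> tC; rewrite leNgt; apply/negP => t0.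
have := tC (Num.truncn (C / t)).+1; rewrite leNgt => /negP; apply.
by rewrite -ltr_pdivrMr // truncnS_gt.
Qed.

(** Convexity of the ball: the points are convex combinations with weights
    [j / K], and multiplying by [K] avoids divisions. *)
Lemma rnorm_segment (R : realType) (V : normedModType R[i]) (z w : V) K j :
  (j <= K)%N -> (0 < K)%N -> rnorm z <= 1 -> rnorm (z + w *+ K) <= 1 ->
  rnorm (z + w *+ j) <= 1.
Proof.
move=> jK K0 z1 zw1.
have E : (z + w *+ j) *+ K = z *+ (K - j) + (z + w *+ K) *+ j.
  rewrite !mulrnDl -!mulrnA addrA -mulrnDr subnK //.
  by rewrite (mulnC K j).
have K0R : 0 < K%:R :> R by rewrite ltr0n.
rewrite -(ler_pM2l K0R) mulr1 -rnormMn E.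
apply: le_trans (rnormD _ _) _; rewrite !rnormMn -[K in leRHS](subnK jK) natrD.
by apply: lerD; apply: ler_piMr.
Qed.

(** The two increments are the entries, up to sign, of one matrix
    [map_mx f x - map_mx f y]; its norm is bounded uniformly in the size, while the
    difference of the increments contributes to it with a factor equal to half
    the size. *)
Lemma coarse_second_difference (R : realType) (X Y : opSpace R) (f : X -> Y)
    (r s : R) p (z z' w : X) :
  (forall n (x y : 'M[X]_n),
      (forall i j, unit_ball X (x i j)) -> (forall i j, unit_ball X (y i j)) ->
      mxnorm (x - y) <= r -> mxnorm (map_mx f x - map_mx f y) <= s) ->
  unit_ball X z -> unit_ball X (z + w) ->
  unit_ball X z' -> unit_ball X (z' + w) ->
  (2 ^ p.+1)%:R * rnorm w <= r ->
  (2 ^ (p + p))%:R * rnorm ((f (z + w) - f z) - (f (z' + w) - f z')) <= s.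
Proof.
move=> fs Bz Bzw Bz' Bzw' wr.
have [S SP Sw] : exists2 S : 'M[bool]_(hadamard_order (p + p) + hadamard_order (p + p)),
    (forall i j, S i (rshift _ j) = ~~ S i (lshift _ j)) &
    mxnorm (\matrix_(i, j) signed (S i j) w) <= (2 ^ p.+1)%:R * rnorm w.
  exists (balanced_sign (p + p)); first exact: balanced_sign_rshift.
  exact: mxnorm_balanced_sign.
pose x := \matrix_(i, j) (if S i j then z' else z + w).
pose y := \matrix_(i, j) (if S i j then z' + w else z).
have xy : x - y = \matrix_(i, j) signed (S i j) w.
  apply/matrixP => i j; rewrite !mxE /signed; case: ifP => _.
    by rewrite opprD addNKr.
  by rewrite addrAC subrr add0r.
have := fs _ x y; rewrite xy => /(_ _ _ _) h.
apply: le_trans (h _ _ _); last first.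
- exact: le_trans Sw wr.
- by move=> i j; rewrite mxE; case: ifP.
- by move=> i j; rewrite mxE; case: ifP.
rewrite -hadamard_orderE; apply: mxnorm_ge_paired => [|i j].
  by rewrite hadamard_orderE expn_gt0.
rewrite !mxE SP.
by case: (S _ _); rewrite /= opprB // [LHS]addrC.
Qed.

Lemma rnorm_sum_nat (R : realType) (V : normedModType R[i]) (n : nat) (F : nat -> V) :
  rnorm (\sum_(0 <= j < n) F j) <= \sum_(0 <= j < n) rnorm (F j).
Proof.
apply: (big_ind2 (fun (u : V) v => rnorm u <= v)) => //; first by rewrite rnorm0.
by move=> u1 v1 u2 v2 le1 le2; apply: le_trans (rnormD _ _) _; exact: lerD.
Qed.

(** Cut [v] into [2 ^ n.+1] steps, each of which changes the two increments by
    amounts that differ by at most [s / 4 ^ n]. *)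
Lemma coarse_increment (R : realType) (X Y : opSpace R) (f : X -> Y)
    (z z' v : X) :
  completely_coarse (unit_ball X) f ->
  unit_ball X z -> unit_ball X (z + v) ->
  unit_ball X z' -> unit_ball X (z' + v) ->
  f (z + v) - f z = f (z' + v) - f z'.
Proof.
move=> fc Bz Bzv Bz' Bzv'.
have [s s0 fs] := fc 2 (ltr0Sn R 1).
(* The ball has diameter [2], and [rnorm w *+ K] is again [rnorm v]: hence the
   choice [r = 2] for every number of steps. *)
have v2 : rnorm v <= 2.
  have -> : v = (z + v) + (-1)%:C *: z.
    by rewrite rmorphN1 scaleN1r addrAC subrr add0r.
  apply: le_trans (rnormD _ _) _; rewrite rnormZ_real normrN1 mul1r.
  have z1 : rnorm z <= 1 := Bz.
  have zv1 : rnorm (z + v) <= 1 := Bzv.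
  lra.
apply/subr0_eq/rnorm0_eq0/le_anti; rewrite rnorm_ge0 andbT.
apply: (@archimedean_le0 _ _ (2 * s)) => n.
apply: (@le_trans _ _ ((2 ^ n)%:R * rnorm (f (z + v) - f z - (f (z' + v) - f z')))).
  by apply: ler_wpM2r; rewrite ?rnorm_ge0 // ler_nat ltnW // ltn_expl.
pose K := (2 ^ n.+1)%N.
have K0 : (0 < K)%N by rewrite expn_gt0.
pose w := natdiv K v.
have wK : w *+ K = v by exact: natdivK.
pose d u j := f (u + w *+ j.+1) - f (u + w *+ j).
have tel u : f (u + v) - f u = \sum_(0 <= j < K) d u j.
  by rewrite (telescope_sumr (fun j => f (u + w *+ j))) // wK mulr0n addr0.
have Bseg u j : unit_ball X u -> unit_ball X (u + v) -> (j <= K)%N ->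
    unit_ball X (u + w *+ j).
  by move=> Bu Buv jK; apply: (@rnorm_segment _ _ _ _ K) => //; rewrite wK.
have step j : (0 <= j < K)%N ->
    (2 ^ (n + n))%:R * rnorm (d z j - d z' j) <= s.
  move=> jK; rewrite /d !mulrSr !addrA.
  apply: coarse_second_difference fs _ _ _ _ _; rewrite -1?addrA -1?mulrSr.
  - by apply: Bseg => //; exact: ltnW.
  - exact: Bseg.
  - by apply: Bseg => //; exact: ltnW.
  - exact: Bseg.
  - by rewrite -/K -rnormMn wK.
rewrite !tel -sumrB.
have n0 : 0 < (2 ^ n)%:R :> R by rewrite ltr0n expn_gt0.
rewrite -(ler_pM2l n0) mulrA -natrM -expnD.
apply: (@le_trans _ _ (\sum_(0 <= j < K) s)); last first.
  by rewrite sumr_const_nat subn0 -[leLHS]mulr_natl /K expnSr natrM mulrA.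
apply: (@le_trans _ _ (\sum_(0 <= j < K) (2 ^ (n + n))%:R * rnorm (d z j - d z' j))).
  rewrite -mulr_sumr; apply: ler_wpM2l => //.
  exact: rnorm_sum_nat.
by apply: ler_sum_nat.
Qed.

(** * Bounded additive maps on the ball *)

Section BallExtension.
Context (R : realType) (V W : normedModType R[i]) (f : V -> W) (M : R).
Hypothesis fD : forall x y : V, rnorm x <= 1 -> rnorm y <= 1 ->
  rnorm (x + y) <= 1 -> f (x + y) = f x + f y.
Hypothesis fM : forall x : V, rnorm x <= 1 -> rnorm (f x) <= M.

Let f0 : f 0 = 0.
Proof.
by have := @fD 0 0; rewrite addr0 rnorm0 => /(_ ler01 ler01 ler01)/eqP;
  rewrite -subr_eq0 opprD addNKr oppr_eq0 => /eqP.
Qed.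

Let f_mulrn n (u : V) : rnorm (u *+ n) <= 1 -> f (u *+ n) = f u *+ n.
Proof.
elim: n => [|n IH] un; first by rewrite !mulr0n f0.
have un' : rnorm (u *+ n) <= 1.
  apply: le_trans un; rewrite !rnormMn; apply: ler_wpM2r; rewrite ?rnorm_ge0 //.
  by rewrite ler_nat.
rewrite !mulrSr fD ?IH -?mulrSr //.
apply: le_trans un; rewrite rnormMn; apply: ler_peMl; rewrite ?rnorm_ge0 //.
by rewrite ler1n.
Qed.

(** Rescale [x] into the ball by an integer at least [rnorm x]. *)
Let g (x : V) : W :=
  let n := (Num.truncn (rnorm x)).+1 in f (natdiv n x) *+ n.

(** Any two rescaling integers give the same value: compare both with their
    product. *)
Let gE n (x : V) : (0 < n)%N -> rnorm x <= n%:R -> g x = f (natdiv n x) *+ n.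
Proof.
have refine m k : (0 < m)%N -> (0 < k)%N -> rnorm x <= m%:R ->
    f (natdiv (k * m) x) *+ (k * m) = f (natdiv m x) *+ m.
  move=> m0 k0 xm; rewrite -(natdiv_mul m x k0) f_mulrn ?mulrnA //.
  by rewrite natdiv_mul // rnorm_natdiv_le1.
move=> n0 xn; rewrite /g; set N := (Num.truncn _).+1.
have xN : rnorm x <= N%:R by rewrite ltW // truncnS_gt.
by rewrite -(refine N n) // mulnC refine.
Qed.

Let gD x y : g (x + y) = g x + g y.
Proof.
pose n := (Num.truncn (rnorm x + rnorm y)).+1.
have xyn : rnorm x + rnorm y <= n%:R by rewrite ltW // truncnS_gt.
have [x0 y0] := (rnorm_ge0 x, rnorm_ge0 y).
have xn : rnorm x <= n%:R by lra.
have yn : rnorm y <= n%:R by lra.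
have sn : rnorm (x + y) <= n%:R by apply: le_trans (rnormD _ _) _.
rewrite !(@gE n) // natdivD fD ?mulrnDl // -?natdivD rnorm_natdiv_le1 //.
Qed.

Let g_bound n x : (0 < n)%N -> rnorm x <= n%:R -> rnorm (g x) <= n%:R * M.
Proof.
move=> n0 xn; rewrite (gE n0 xn) rnormMn ler_wpM2l // fM //.
exact: rnorm_natdiv_le1.
Qed.

(** With [k] the integral part of [n * a] and [c] its fractional part, additivity
    reduces [n] times the defect of homogeneity at [a] to the defect at [c],
    which is bounded independently of [n]. *)
Let gZ (a : R) x : g (a%:C *: x) = a%:C *: g x.
Proof.
have gB : zmod_morphism g.
  by move=> u v; apply/eqP; rewrite eq_sym subr_eq -gD subrK.
pose gm := GRing.isZmodMorphism.Build V W g gB.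
pose G : {additive V -> W} := HB.pack g gm.
pose N := (Num.truncn (rnorm x)).+1.
have xN : rnorm x <= N%:R by rewrite ltW // truncnS_gt.
apply/subr0_eq/rnorm0_eq0/le_anti; rewrite rnorm_ge0 andbT.
apply: (@archimedean_le0 _ _ (N%:R * M + rnorm (g x))) => n.
rewrite -rnormMn.
pose k := Num.floor (n%:R * a); pose c := n%:R * a - k%:~R.
have /andP[c0 c1] : 0 <= c < 1.
  by rewrite subr_ge0 ltrBlDl floor_le -intrD1 floorD1_gt.
have nc : n%:R * a = k%:~R + c by rewrite /c addrC subrK.
have nE (U : normedModType R[i]) (u : U) : (a%:C *: u) *+ n = u *~ k + c%:C *: u.
  rewrite -scaler_nat scalerA -(rmorph_nat (real_complex R)) -rmorphM nc.
  by rewrite rmorphD scalerDl rmorph_int scaler_int.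
have -> : (g (a%:C *: x) - a%:C *: g x) *+ n = g (c%:C *: x) + (- c)%:C *: g x.
  rewrite mulrnBl nE -[g (_ *: x)]/(G _) -raddfMn nE raddfD raddfMz /=.
  by rewrite rmorphN scaleNr opprD addrACA subrr add0r.
apply: le_trans (rnormD _ _) _; apply: lerD.
  apply: g_bound => //; apply: le_trans xN.
  by rewrite rnormZ_real ger0_norm // ler_piMl ?rnorm_ge0 // ltW.
by rewrite rnormZ_real normrN ger0_norm // ler_piMl ?rnorm_ge0 // ltW.
Qed.

Lemma additive_ball_real_linear :
  exists2 g : V -> W, real_linear g & forall x, rnorm x <= 1 -> f x = g x.
Proof.
exists g => [a x y|x x1]; first by rewrite gD gZ.
by rewrite (@gE 1%N) // /natdiv invr1 scale1r.
Qed.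

End BallExtension.

Theorem theorem1p3 (R : realType) (X Y : opSpace R) (f : X -> Y) :
  completely_coarse (unit_ball X) f -> f 0 = 0 ->
  exists2 g : X -> Y, real_linear g & forall x, unit_ball X x -> f x = g x.
Proof.
move=> fc f0.
have B0 : unit_ball X 0 by rewrite /unit_ball /= rnorm0.
have [s s0 fs] := fc 1 ltr01.
apply: (@additive_ball_real_linear _ _ _ f s) => [x y Bx By Bxy|x Bx].
  (* The increment by [x] is the same at [y] and at the origin. *)
  have := @coarse_increment _ _ _ f y 0 x fc.
  rewrite !add0r f0 subr0 [y + x]addrC => <- //; first by rewrite subrK.
(* Complete coarseness in size [1], with [0] as second point, bounds [f]. *)
have := fs 1%N (const_mx x) (const_mx 0).
rewrite !map_const_mx -!raddfB !subr0 f0 subr0 !mxnorm_const1.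
by apply=> // i j; rewrite mxE.
Qed.
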